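(* Let $A\subset\mathbb{C}$ be a finite set. Then \[ |A+A-A|\,|AA|^2 \gg |A|^4, \] with an absolute implied constant.
   Context: $A+A-A=\{a+a'-a'':a,a',a''\in A\}$ and $AA=\{aa':a,a'\in A\}$. The notation $X\gg Y$ means $X\ge cY$ for an absolute constant $c>0$. *)

(* Defs.v *)
From HB Require Import structures.
From mathcomp Require Import all_boot all_order all_algebra.
From mathcomp Require Import finmap reals.
From mathcomp Require Import complex.

Set Implicit Arguments.
Unset Strict Implicit.
Unset Printing Implicit Defensive.

Import Order.TTheory GRing.Theory Num.Theory.

Local Open Scope fset_scope.
Local Open Scope ring_scope.

Definition sum_diff_set (V : zmodType) (A : {fset V}) : {fset V} :=
  [fset p.1 + p.2 - a | p in A `*` A, a in A].

Definition product_set (K : comNzRingType) (A : {fset K}) : {fset K} :=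
  [fset a * a' | a in A, a' in A].

(* Main.v *)
Require Import Defs.
From HB Require Import structures.
From mathcomp Require Import all_boot all_order all_algebra.
From mathcomp Require Import finmap reals.
From mathcomp Require Import complex.
From mathcomp Require Import zify ring lra.

(** Let [a'] denote a nearest neighbour of [a] in [A \ {0}], and send a triple
    [(a, b, c)] to [(b + a' - a, ac, a'c)].  If [a] is at most as far from [a'] as
    [b] is from [b'], then [b + a' - a] lies in the disc about [b] through
    [b'], and a point lies in boundedly many such discs; so the first coordinate
    leaves boundedly many choices for [b], after which [a' - a], and then [c]
    and [a], can be read off.  Moreover, by the same overlap bound applied to
    the dilate of [A] by [c], for most pairs [(a, c)] the point [a'c] is among
    the [O(|AA| / |A|)] points of [AA] closest to [ac].  Hence
    [|A|^3 << |A+A-A| |AA| (|AA| / |A|)]. *)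

Set Implicit Arguments.
Unset Strict Implicit.
Unset Printing Implicit Defensive.

Import Order.TTheory GRing.Theory Num.Theory.

Local Open Scope fset_scope.
Local Open Scope ring_scope.

Lemma card_le_fibres (T U : finType) (f : T -> U) (D : {set T}) (E : {set U})
    (k : nat) :
  {in D, forall x, f x \in E} ->
  {in E, forall y, (#|[set x in D | f x == y]| <= k)%N} ->
  (#|D| <= k * #|E|)%N.
Proof.
move=> fDE fk; rewrite -sum1_card (partition_big f (mem E)) //=.
rewrite mulnC -sum_nat_const; apply: leq_sum => y Ey.
by rewrite sum1dep_card; apply: leq_trans (fk y Ey); rewrite cardsE.
Qed.

(** * Plane geometry: bounded overlap of discs *)

Section SquaredModulus.
Variable R : rcfType.
Implicit Types u v : R[i].

Definition normsq u : R := complex.Re u ^+ 2 + complex.Im u ^+ 2.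

Lemma normsq_ge0 u : 0 <= normsq u.
Proof. by rewrite addr_ge0 ?sqr_ge0. Qed.

Lemma normsqB u v : normsq (u - v) = normsq (v - u).
Proof. by case: u v => [a b] [c d]; rewrite /normsq /=; ring. Qed.

Lemma normsqM u v : normsq (u * v) = normsq u * normsq v.
Proof. by case: u v => [a b] [c d]; rewrite /normsq /=; ring. Qed.

(* [0] gets a class of its own: [octant_far] fails for it against any [v]. *)
Definition octant u : bool * bool * bool * bool :=
  (u == 0, 0 <= complex.Re u, 0 <= complex.Im u,
   complex.Re u ^+ 2 <= complex.Im u ^+ 2).

(** This is cos 2(s - t) = cos 2s cos 2t + sin 2s sin 2t cleared of moduli; equal octants make both
    products nonnegative. *)
Lemma octant_angle u v : octant u = octant v ->
  normsq u * normsq v <=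
    2 * (complex.Re u * complex.Re v + complex.Im u * complex.Im v) ^+ 2 /\
  0 <= complex.Re u * complex.Re v + complex.Im u * complex.Im v.
Proof.
case: u v => [a b] [c d] [_ hre him hab] /=; rewrite /normsq /=.
have ac : 0 <= a * c.
  move: hre => /=; case: (lerP 0 a) => ha /esym hc.
    by rewrite mulr_ge0.
  by rewrite mulr_le0 ?ltW // ltNge hc.
have bd : 0 <= b * d.
  move: him => /=; case: (lerP 0 b) => hb /esym hd.
    by rewrite mulr_ge0.
  by rewrite mulr_le0 ?ltW // ltNge hd.
split; last exact: addr_ge0.
have sq : 0 <= (a ^+ 2 - b ^+ 2) * (c ^+ 2 - d ^+ 2).
  move: hab => /=; case: (lerP (a ^+ 2) (b ^+ 2)) => hb /esym hd.
    by rewrite mulr_le0 ?subr_le0.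
  by rewrite mulr_ge0 // subr_ge0 ltW // ltNge hd.
have := mulr_ge0 ac bd; rewrite -subr_ge0 => abcd; rewrite -subr_ge0.
have -> : 2 * (a * c + b * d) ^+ 2 - (a ^+ 2 + b ^+ 2) * (c ^+ 2 + d ^+ 2)
  = (a ^+ 2 - b ^+ 2) * (c ^+ 2 - d ^+ 2) + 4 * (a * c * (b * d) - 0) by ring.
by rewrite addr_ge0 // mulr_ge0.
Qed.

Lemma normsq_eq0 u : normsq u = 0 -> u = 0.
Proof.
case: u => a b; rewrite /normsq /= => /eqP.
by rewrite paddr_eq0 ?sqr_ge0 // !sqrf_eq0 => /andP[/eqP-> /eqP->].
Qed.

(* Both conditions say that the angle between [u] and [v] is at least 60
   degrees, whereas two nonzero vectors in one octant are within 45 degrees. *)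
Lemma octant_far u v : octant u = octant v ->
  normsq u <= normsq (u - v) -> normsq v <= normsq (u - v) -> u = v.
Proof.
move=> uv; have [] := octant_angle uv.
have -> : normsq (u - v) = normsq u + normsq v -
    2 * (complex.Re u * complex.Re v + complex.Im u * complex.Im v).
  by case: (u) (v) => [a b] [c d]; rewrite /normsq /=; ring.
set w := _ + _ => h w0 hu hv.
(* The distance bounds give [2 * w <= normsq u] and [2 * w <= normsq v]; their product contradicts
   [h] unless a vector vanishes. *)
have z : normsq u * normsq v = 0.
  have := normsq_ge0 u; have := normsq_ge0 v => v0 u0.
  have : 4 * w ^+ 2 <= normsq u * normsq v.
    have -> : 4 * w ^+ 2 = (2 * w) * (2 * w) by ring.
    by apply: ler_pM; lra.
  by have := mulr_ge0 u0 v0; lra.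
case: uv => e0 _ _ _; move/eqP: z; rewrite mulf_eq0.
by case/orP=> /eqP/normsq_eq0 z; move: e0; rewrite z eqxx;
  [move/esym/eqP->|move/eqP->].
Qed.

(** Here [r i] is a squared radius, and no disc has another centre in its interior. By [octant_far],
    centres of discs containing [s] lie in distinct octants as seen from [s]; 16 counts all Boolean
    4-tuples. *)
Lemma disc_overlap (I : finType) (x : I -> R[i]) (r : I -> R) (s : R[i]) :
  injective x -> (forall i j, i != j -> r i <= normsq (x j - x i)) ->
  (#|[set i | (normsq (s - x i) <= r i)%R]| <= 16)%N.
Proof.
move=> xI sep; set D := finset _.
have <- : #|{: bool * bool * bool * bool}| = 16%N by rewrite !card_prod card_bool.
rewrite -(@card_in_imset _ _ (fun i => octant (x i - s)) D) ?max_card //.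
move=> i j; rewrite !inE => Di Dj /octant_far.
have -> : x i - s - (x j - s) = x i - x j by ring.
rewrite (normsqB (x i) s) (normsqB (x j) s) => uv.
apply/eqP/negPn/negP => ij; move/eqP: (ij); apply; apply/xI/(addIr (- s))/uv.
  by rewrite (normsqB (x i)) (le_trans Di) ?sep.
by rewrite (le_trans Dj) // sep // eq_sym.
Qed.

End SquaredModulus.

(** * Counting triples via nearest neighbours *)

Section NearestNeighbours.
Variables (R : rcfType) (I : finType) (x : I -> R[i]) (nb : I -> I).
Hypothesis xI : injective x.
Hypothesis x_neq0 : forall i, x i != 0.
Hypothesis nb_neq : forall i, nb i != i.

Let gap i := normsq (x (nb i) - x i).

Hypothesis nb_min : forall i j, j != i -> gap i <= normsq (x j - x i).

Variables S P : {fset R[i]}.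
Hypothesis S_sum_diff : forall i j k, x i + x j - x k \in S.
Hypothesis P_prod : forall i j, x i * x j \in P.

Let N := #|I|.

(** The disc about [x i] through [x (nb i)], dilated by [x j]. *)
Definition prod_disc i j : {set P} :=
  [set q : P | (normsq (val q - x i * x j) <= gap i * normsq (x j))%R].

(** Double counting: dilation by [x j] preserves the separation, so [disc_overlap] applies at each
    point of [P]. *)
Lemma sum_prod_disc j : (\sum_i #|prod_disc i j| <= #|` P| * 16)%N.
Proof.
under eq_bigr do rewrite -sum1_card big_mkcond.
rewrite exchange_big /= cardfE -sum_nat_const; apply: leq_sum => q _.
rewrite -big_mkcond sum1dep_card.
under eq_finset do rewrite inE.
apply: disc_overlap => [i k /(mulIf (x_neq0 j)) /xI //|i k ik].
rewrite -mulrBl normsqM ler_wpM2r ?normsq_ge0 // nb_min // eq_sym //.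
Qed.

Definition sparse i j := (#|prod_disc i j| * N <= 64 * #|` P|)%N.

(** Markov's inequality: the 64 in [sparse] is four times the 16 of [sum_prod_disc]. *)
Lemma card_not_sparse j : (#|[set i | ~~ sparse i j]| * 4 <= N)%N.
Proof.
set B := finset _.
have [->|[i0 _]] := set_0Vmem B; first by rewrite cards0.
have P_gt0 : (0 < #|` P|)%N.
  by rewrite cardfs_gt0; apply/fset0Pn; exists (x i0 * x i0).
rewrite -(@leq_pmul2r (16 * #|` P|)) ?muln_gt0 //.
apply: (@leq_trans (\sum_(i in B) #|prod_disc i j| * N)).
  rewrite -mulnA (mulnA 4) -sum_nat_const; apply: leq_sum => i.
  by rewrite inE /sparse -ltnNge => /ltnW.
rewrite -big_distrl /= mulnC leq_mul2l [(16 * _)%N]mulnC.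
apply/orP; right; apply: leq_trans (sum_prod_disc j).
by rewrite [X in (_ <= X)%N](bigID (mem B)) /= leq_addr.
Qed.

Definition good_triples : {set I * I * I} :=
  [set t | (gap t.1.1 <= gap t.1.2) && sparse t.1.1 t.2].

(** By swapping, at least half of the pairs satisfy the gap condition; sparsity costs at most a
    quarter of all triples. *)
Lemma card_good_triples : (N ^ 3 <= 4 * #|good_triples|)%N.
Proof.
pose L := [set p : I * I | gap p.1 <= gap p.2].
have cL : (N ^ 2 <= 2 * #|L|)%N.
  have -> : (N ^ 2 = #|{: I * I}|)%N by rewrite card_prod.
  rewrite -(cardsC L) mul2n -addnn leq_add2l.
  have swapI : injective (fun p : I * I => (p.2, p.1)).
    by case=> [? ?] [? ?] [-> ->].
  rewrite -(card_imset (~: L) swapI).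
  apply/subset_leq_card/subsetP => _ /imsetP[p + ->].
  by rewrite !inE -ltNge => /ltW.
pose B := [set t : I * I * I | ~~ sparse t.1.1 t.2].
have cB : (#|B| * 4 <= N ^ 3)%N.
  have : (#|B| <= #|[set p : I * I | ~~ sparse p.1 p.2]| * N)%N.
    rewrite mulnC; pose f (t : I * I * I) := (t.1.1, t.2).
    apply: (@card_le_fibres _ _ f) => [t|p _]; first by rewrite !inE.
    rewrite -(@card_in_imset _ _ (fun t => t.1.2)) ?max_card //.
    case=> [[i b] j] [[i' b'] j']; rewrite !inE /f /=.
    by move=> /andP[_ /eqP<-] /andP[_ /eqP[-> ->]] ->.
  have : (#|[set p : I * I | ~~ sparse p.1 p.2]| * 4 <= N * N)%N.
    rewrite -sum1_card (partition_big snd predT) //= big_distrl /=.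
    rewrite -{1}sum_nat_const; apply: leq_sum => j _.
    apply: leq_trans (card_not_sparse j); rewrite leq_mul2r /=.
    rewrite sum1dep_card -(@card_in_imset _ _ fst).
      apply/subset_leq_card/subsetP => _ /imsetP[[i k] + ->].
      by rewrite !inE /= => /andP[+ /eqP<-].
    case=> [i k] [i' k']; rewrite !inE /=.
    by move=> /andP[_ /eqP->] /andP[_ /eqP->] ->.
  by rewrite /expn /=; nia.
have : (#|L| * N <= #|good_triples| + #|B|)%N.
  rewrite /N -[#|I|]cardsT -cardsX -cardsUI.
  apply: leq_trans (leq_addr _ _); apply/subset_leq_card/subsetP.
  by case=> [[i b] j]; rewrite !inE /= andbT => ->; case: sparse.
rewrite !expnS expn0 in cB cL *; nia.
Qed.

(* The disc is the one about [p.1] through [p.2]; as these discs are nested for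
   fixed [p.1], only [64 |P| / N] points [p.2] can occur with a given [p.1]. *)
Definition near_pairs : {set P * P} :=
  [set p | #|[set q : P | (normsq (val q - val p.1)
                           <= normsq (val p.2 - val p.1))%R]| * N <= 64 * #|` P|]%N.

Lemma card_near_pairs : (#|near_pairs| * N <= 64 * #|` P| ^ 2)%N.
Proof.
have [->|N_gt0] := posnP N; first by rewrite muln0.
have: (#|near_pairs| <= (64 * #|` P| %/ N) * #|[set: P]|)%N.
  apply: (@card_le_fibres _ _ fst) => [p _|p _]; first by rewrite in_setT.
  set D := finset _; have [->|[d0 Dd0]] := set_0Vmem D; first by rewrite cards0.
  (* The disc through the farthest second point contains all the others, so its bound controls the
     fibre. *)
  case: (arg_maxP (fun d : P * P => normsq (val d.2 - val d.1)) Dd0) => d Dd dmax.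
  have : d \in D by []; rewrite leq_divRL // inE => /andP[+ /eqP dp].
  rewrite inE; apply: leq_trans; rewrite leq_mul2r; apply/orP; right.
  rewrite -(@card_in_imset _ _ snd).
    apply/subset_leq_card/subsetP => _ /imsetP[e De ->].
    have := dmax _ De; move: De; rewrite !inE dp => /andP[_ /eqP->] //.
  case=> [i k] [i' k']; rewrite !inE /=.
  by move=> /andP[_ /eqP->] /andP[_ /eqP->] ->.
rewrite cardsT -cardfE; have := leq_trunc_div (64 * #|` P|) N.
rewrite expnS expn1; nia.
Qed.

Lemma card_good_triples_le : (#|good_triples| <= 16 * (#|` S| * #|near_pairs|))%N.
Proof.
pose f (t : I * I * I) : S * (P * P) :=
  ([` S_sum_diff t.1.2 (nb t.1.1) t.1.1],
   ([` P_prod t.1.1 t.2], [` P_prod (nb t.1.1) t.2])).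
have -> : (#|` S| * #|near_pairs| = #|setX [set: S] near_pairs|)%N.
  by rewrite cardsX cardsT -cardfE.
apply: (@card_le_fibres _ _ f) => [[[i b] j]|[s [p q]] _].
  by rewrite !inE /= => /andP[_]; rewrite /sparse /prod_disc -mulrBl normsqM.
(* As [s - x b = x (nb i) - x i], the gap condition puts [s] in the disc about [x b]. *)
apply: leq_trans (@disc_overlap _ _ x gap (val s) xI _); last first.
  by move=> i j ij; rewrite nb_min // eq_sym.
rewrite -(@card_in_imset _ _ (fun t => t.1.2)).
  apply/subset_leq_card/subsetP => _ /imsetP[[[i b] j] + ->].
  rewrite !inE /= => /andP[/andP[+ _] /eqP[<- _ _]] /=.
  by rewrite (_ : _ - x b = x (nb i) - x i) //; ring.
case=> [[i b] j] [[i' b'] j']; rewrite !inE /=.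
move=> /andP[_ /eqP[e1 e2 e3]] /andP[_ /eqP[f1 f2 f3]] bb.
have /= := congr1 val (etrans e1 (esym f1)); rewrite -bb -!addrA => /addrI eg.
have /= ep := congr1 val (etrans e2 (esym f2)).
have /= eq := congr1 val (etrans e3 (esym f3)).
(* The nonzero difference [x (nb i) - x i] is fixed by [s] and [b]; multiplied by [x j] it gives
   [q - p], which determines [j], and then [p] determines [i]. *)
have ej : j = j'.
  apply/esym/xI/(mulfI (x:=x (nb i) - x i)).
    by rewrite subr_eq0 (inj_eq xI).
  by rewrite {1}eg !mulrBl ep eq.
rewrite ej in ep *; congr (_, _, _).
by move/(mulIf (x_neq0 j')): ep => /xI.
Qed.

(** The constant is 4 * 16 * 64, one factor from each of the three preceding counts. *)
Lemma nearest_neighbour_bound : (N ^ 4 <= 2 ^ 12 * #|` S| * #|` P| ^ 2)%N.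
Proof.
rewrite expnSr (leq_trans (leq_mul card_good_triples (leqnn N))) //.
rewrite (@leq_trans (64 * #|` S| * (#|near_pairs| * N))) //.
  by have := card_good_triples_le; nia.
apply: leq_trans (leq_mul (leqnn _) card_near_pairs) _.
by apply: eq_leq; rewrite (expnD 2 6 6) mulnACA mulnA.
Qed.

End NearestNeighbours.

(** * Application to a finite set of complex numbers *)

Lemma nearest_neighbour_exists (R : rcfType) (I : finType) (x : I -> R[i]) :
  (1 < #|I|)%N -> exists nb : I -> I, forall i, nb i != i /\
    forall j, j != i -> normsq (x (nb i) - x i) <= normsq (x j - x i).
Proof.
move=> I_gt1; apply: (@fin_all_exists _ (fun=> I)
  (fun i k => k != i /\ forall j, j != i -> normsq (x k - x i) <= normsq (x j - x i))).
move=> i; have /card_gt0P[j0] : (0 < #|predC1 i|)%N by rewrite cardC1; lia.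
rewrite !inE => j0i.
case: (arg_minP (P := fun j => j != i) (fun j => normsq (x j - x i)) j0i).
by move=> k ki kmin; exists k.
Qed.

Lemma card_sum_diff_product (R : rcfType) (A : {fset R[i]}) :
  (#|` A| ^ 4 <= 2 ^ 16 * (#|` sum_diff_set A| * #|` product_set A| ^ 2))%N.
Proof.
have sumP a b c : a \in A -> b \in A -> c \in A -> a + b - c \in sum_diff_set A.
  move=> Aa Ab Ac.
  apply: (in_imfset2 _ (fun (p : R[i] * R[i]) a => p.1 + p.2 - a) (x := (a, b))) => //=.
  by rewrite inE /= Aa Ab.
have prodP a b : a \in A -> b \in A -> a * b \in product_set A.
  by move=> Aa Ab; apply: (in_imfset2 _ (fun a b : R[i] => a * b)).
have [->|[a0 Aa0]] := fset_0Vmem A; first by rewrite cardfs0.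
have S_gt0 : (0 < #|` sum_diff_set A|)%N.
  by rewrite cardfs_gt0; apply/fset0Pn; exists (a0 + a0 - a0); apply: sumP.
have P_gt0 : (0 < #|` product_set A|)%N.
  by rewrite cardfs_gt0; apply/fset0Pn; exists (a0 * a0); apply: prodP.
pose B := A `\ 0; have BA (b : B) : val b \in A.
  by have := valP b; rewrite !inE => /andP[].
have AB : (#|` A| <= #|` B|.+1)%N.
  by rewrite (cardfsD1 0 A) -addn1 addnC leq_add2l leq_b1.
(* A nearest neighbour requires two nonzero points; otherwise [2 ^ 4 <= 2 ^ 16] suffices, as both
   sets are nonempty. *)
have [B_le1|B_gt1] := leqP #|` B| 1.
  have A_le2 : (#|` A| <= 2)%N by lia.
  apply: (@leq_trans (2 ^ 4)); first by rewrite leq_exp2r.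
  by rewrite -[(2 ^ 4)%N]muln1 leq_mul ?leq_exp2l // muln_gt0 S_gt0 expn_gt0 P_gt0.
rewrite cardfE in B_gt1.
have [nb nbP] := @nearest_neighbour_exists R B val B_gt1.
have := @nearest_neighbour_bound R B val nb val_inj _ _ _
  (sum_diff_set A) (product_set A).
rewrite -cardfE in B_gt1 *; move=> /(_ _ _ _ _ _) bound.
have {}bound : (#|` B| ^ 4 <=
    2 ^ 12 * #|` sum_diff_set A| * #|` product_set A| ^ 2)%N.
  apply: bound => [b|b|b c cb|a b c|a b].
  - by have := valP b; rewrite !inE => /andP[].
  - by case: (nbP b).
  - by case: (nbP b) => _; apply.
  - by apply: sumP.
  - by apply: prodP.
(* Restoring 0 at most doubles the cardinality, hence the extra factor [2 ^ 4]. *)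
apply: (@leq_trans ((2 * #|` B|) ^ 4)); first by rewrite leq_exp2r //; lia.
rewrite expnMn; apply: leq_trans (leq_mul (leqnn _) bound) _.
by apply: eq_leq; rewrite (expnD 2 4 12) !mulnA.
Qed.

Theorem theorem1p5 (R : realType) :
  exists c : R, 0 < c /\
    forall A : {fset R[i]},
      c * #|` A |%:R ^+ 4
        <= #|` sum_diff_set A |%:R * #|` product_set A |%:R ^+ 2.
Proof.
exists (2 ^+ 16)^-1; split; first by rewrite invr_gt0 exprn_gt0.
move=> A; rewrite ler_pdivrMl ?exprn_gt0 // -!natrX -!natrM ler_nat.
exact: card_sum_diff_product.
Qed.
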